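(* Assume that $\Sigma\sim O(1)$ and $\tilde\Sigma$ are both constants (independent of $\theta$). Then there exist steady-state distributions $p^\infty,\hat p^\infty$ for the equations $$\partial_t p=\nabla\cdot\Big[(\nabla J)\,p+\tfrac{\eta}{2}\nabla\cdot(\Sigma p)\Big],\qquad \partial_t\hat p=\nabla\cdot\Big[(\nabla J+\nabla\tilde J)\,\hat p+\tfrac{\eta}{2}\nabla\cdot\big((\Sigma+\tilde\Sigma)\hat p\big)\Big]$$ on $\Omega$ with reflecting boundary conditions, respectively, given by $$p^\infty(\theta)=\frac1Z e^{-\beta J(\theta)},\qquad \hat p^\infty(\theta)=\frac1{\hat Z}e^{-\hat\beta (J(\theta)+\tilde J(\theta))},\qquad \beta=\frac{2}{\eta\Sigma},\qquad \hat\beta=\frac{2}{\eta(\Sigma+\tilde\Sigma)},$$ where $Z=\int_\Omega e^{-2J/(\eta\Sigma)}\,d\theta$ and $\hat Z=\int_\Omega e^{-2(J+\tilde J)/(\eta(\Sigma+\tilde\Sigma))}\,d\theta$ are normalizing constants. In addition, $$\left\|\frac{\hat p^\infty}{p^\infty}\right\|_{L^\infty}\le 1+O\!\left(\frac{\epsilon^2}{\eta}\right).$$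
   Context: Underlying chain: $s_{m+1}=s_m+\alpha(s_m)\epsilon+\sigma(s_m)\sqrt\epsilon\,Z_m$ on a compact state space $\mathbb S\subset\mathbb R^{d_s}$, with $Z_m$ independent standard normal vectors, time step $\epsilon>0$, and a prescribed boundary condition when the state reaches the boundary; $\Delta s_m=s_{m+1}-s_m=\alpha(s_m)\epsilon+\sigma(s_m)\sqrt\epsilon\,Z_m$. The parameter domain $\Omega\subset\mathbb R^d$ is a bounded connected open set. The Bellman residual is $f(s_1,s_2;\theta)=R(s_1)+\gamma V(s_2;\theta)-V(s_1;\theta)$, with $\gamma\in(0,1)$, where the reward $R$ and the parametrized value function $V$ are bounded. Objective functions (outer expectation over $s_m$): $$J(\theta)=\mathbb E\Big[\tfrac12\big(\mathbb E[f(s_m,s_{m+1};\theta)\mid s_m]\big)^2\Big],\qquad \hat J(\theta)=\tfrac12\mathbb E\Big[\mathbb E[f(s_m,s_{m+1};\theta)\mid s_m]\,\mathbb E[f(s_m,s_m+\Delta s_{m+1};\theta)\mid s_m]\Big],$$ and $\tilde J=\hat J-J$. Also $$\tilde j(s_m;\theta)=\mathbb E[f(s_m,s_{m+1};\theta)\mid s_m]\,\mathbb E[f(s_m,s_m+\Delta s_{m+1};\theta)-f(s_m,s_m+\Delta s_m;\theta)\mid s_m].$$ With $\mathbb V$ denoting variance, set $$\Sigma=\mathbb V\Big[\tfrac12(\mathbb E[f(s_m,s_{m+1};\theta)\mid s_m])^2\Big],\qquad \tilde\Sigma=\mathbb V\Big[\tfrac12(\mathbb E[f(s_m,s_{m+1};\theta)\mid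 s_m])^2+\tilde j\Big]-\Sigma .$$ $\eta>0$ is the ratio of the learning rate to the batch size. For scalar constant $\Sigma$, $\nabla\cdot(\Sigma p)$ is read as $\nabla(\Sigma p)=\Sigma\nabla p$ (similarly for $\hat p$). The two equations are the Fokker–Planck equations for the stochastic-differential-equation approximations of unbiased SGD on $J$ and SGD on $\hat J$. Reflecting boundary conditions, with $\vec n$ the normal to $\partial\Omega$: $\big((\nabla J)p+\frac\eta2\nabla\cdot(\Sigma p)\big)\cdot\vec n=0$ and $\big((\nabla J+\nabla\tilde J)\hat p+\frac\eta2\nabla\cdot((\Sigma+\tilde\Sigma)\hat p)\big)\cdot\vec n=0$ on $\partial\Omega$. Standing assumptions: $\tilde J$, $\nabla\tilde J$ and $\tilde\Sigma$ are $O(\epsilon^2)$ (uniformly in $\theta\in\Omega$); $\int e^{-J}d\theta<\infty$ and $\int e^{-\hat J}d\theta<\infty$; and the matrices $\|H(J)\|_{L^\infty_\theta}$, $\|H(\hat J)\|_{L^\infty_\theta}$ ($H$ is the Hessian, $L^\infty_\theta$ norm taken entrywise) have Frobenius norms bounded by a constant $M$. ''$\Sigma\sim O(1)$'' means that $\Sigma$ is a positive constant of order one. The norm $L^\infty$ is over $\theta\in\Omega$, and $O(\cdot)$ refers to the regime where $\epsilon$ and $\epsilon^2/\eta$ are small, with implied constants independent of $\epsilon$ and $\eta$. *)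

(* Defs.v *)
From HB Require Import structures.
From mathcomp Require Import all_boot all_order all_algebra.
From mathcomp Require Import all_classical all_reals all_analysis.

Set Implicit Arguments.
Unset Strict Implicit.
Unset Printing Implicit Defensive.

Import Order.TTheory GRing.Theory Num.Theory.
Import numFieldNormedType.Exports.

Local Open Scope classical_set_scope.
Local Open Scope ring_scope.

Definition rV_display : measure_display. Proof. exact: default_measure_display. Qed.

(* The sigma-algebra generated by the coordinates, that is, the Borel
   sigma-algebra of the (second countable) product topology of ['rV[R]_n]. *)
Section measurable_rV.
Context (R : realType) (n : nat).

Let coord (i : 'I_n) (v : 'rV[R]_n) : R := v ord0 i.

Let rV_set0 : g_sigma_preimage coord set0.
Proof. exact: sigma_algebra0. Qed.

Let rV_setC A : g_sigma_preimage coord A -> g_sigma_preimage coord (~` A).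
Proof. exact: sigma_algebraC. Qed.

Let rV_bigcup (F : (set 'rV[R]_n)^nat) :
  (forall i, g_sigma_preimage coord (F i)) ->
  g_sigma_preimage coord (\bigcup_i F i).
Proof. exact: sigma_algebra_bigcup. Qed.

HB.instance Definition _ := @isMeasurable.Build rV_display 'rV[R]_n
  (g_sigma_preimage coord) rV_set0 rV_setC rV_bigcup.

Lemma measurable_rV_coord (i : 'I_n) :
  measurable_fun [set: 'rV[R]_n] (fun v : 'rV[R]_n => v ord0 i).
Proof.
move=> _ Y mY; rewrite setTI; apply: sub_sigma_algebra => /=.
rewrite -bigcup_seq/=; exists i => /=; first by rewrite mem_index_enum.
by exists Y => //; rewrite setTI.
Qed.

Lemma measurable_fun_rVP d (T : measurableType d) (f : T -> 'rV[R]_n) :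
  (forall i, measurable_fun [set: T] (fun x => f x ord0 i)) ->
  measurable_fun [set: T] f.
Proof.
move=> mf _ A mA; rewrite setTI.
suff H : g_sigma_preimage coord `<=` [set B | measurable (f @^-1` B)] by exact: H.
apply: smallest_sub.
  split => [|B mB|F mF] /=.
  - by rewrite preimage_set0.
  - by rewrite setTD preimage_setC; exact: measurableC.
  - by rewrite preimage_bigcup; apply: bigcup_measurable => k _; exact: mF.
rewrite -bigcup_seq/= => B [i _ [C mC <-]] /=.
by rewrite setTI; have := mf i measurableT C mC; rewrite setTI.
Qed.

End measurable_rV.

Section lebesgue_rV.
Context (R : realType).

Definition rV_cons n (xv : measurableTypeR R * 'rV[R]_n) : 'rV[R]_n.+1 :=
  \row_i oapp (xv.2 ord0) xv.1 (unlift ord0 i).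

Let rV_uncons n (v : 'rV[R]_n.+1) : measurableTypeR R * 'rV[R]_n :=
  (v ord0 ord0, \row_i v ord0 (lift ord0 i)).

Lemma measurable_rV_cons n : measurable_fun [set: _] (@rV_cons n).
Proof.
apply: measurable_fun_rVP => i.
rewrite (_ : (fun _ => _) =
    fun xv : measurableTypeR R * 'rV[R]_n => oapp (xv.2 ord0) xv.1 (unlift ord0 i)).
  case: unliftP => [j _|_] /=; last exact: measurable_fst.
  apply: (measurableT_comp (@measurable_rV_coord R n j)).
  exact: measurable_snd.
by apply/funext => xv; rewrite mxE.
Qed.

Let measurable_rV_uncons n : measurable_fun [set: _] (@rV_uncons n).
Proof.
apply: measurable_fun_pair; first exact: measurable_rV_coord.
apply: measurable_fun_rVP => i.
rewrite (_ : (fun _ => _) = fun v : 'rV[R]_n.+1 => v ord0 (lift ord0 i)).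
  exact: measurable_rV_coord.
by apply/funext => v; rewrite mxE.
Qed.

Let rV_consK n : cancel (@rV_cons n) (@rV_uncons n).
Proof.
case=> x v; rewrite /rV_uncons !mxE unlift_none /=; congr pair.
by apply/rowP => i; rewrite !mxE liftK.
Qed.

Section step.
Local Open Scope ereal_scope.
Context (n : nat) (m : {sigma_finite_measure set 'rV[R]_n -> \bar R}).

Definition lebesgue_rV_step : set 'rV[R]_n.+1 -> \bar R :=
  pushforward (@lebesgue_measure R \x m) (@rV_cons n).

HB.instance Definition _ := Measure.copy lebesgue_rV_step
  (measure_function_pushforward__canonical__measure_function_Measure
     (@lebesgue_measure R \x m) (@measurable_rV_cons n)).

Let lebesgue_rV_step_sigma_finite : sigma_finite [set: _] lebesgue_rV_step.
Proof.
have /sigma_finiteP[F [FT Fh mF]] := sigma_finiteT (@lebesgue_measure R).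
have /sigma_finiteP[G [GT Gh mG]] := sigma_finiteT m.
exists (fun k => @rV_uncons n @^-1` (F k `*` G k)) => [|k].
  apply/seteqP; split => // v _.
  have : (\bigcup_i F i) (rV_uncons v).1 by rewrite -FT.
  move=> [i _ Fi].
  have : (\bigcup_i G i) (rV_uncons v).2 by rewrite -GT.
  move=> [j _ Gj].
  exists (maxn i j) => //; split => /=.
    by have /subsetPset := Fh _ _ (leq_maxl i j); apply.
  by have /subsetPset := Gh _ _ (leq_maxr i j); apply.
have [mFk Fkoo] := mF k.
have [mGk Gkoo] := mG k.
split.
  rewrite -[X in measurable X]setTI.
  by apply: measurable_rV_uncons => //; exact: measurableX.
rewrite /lebesgue_rV_step /pushforward -comp_preimage.
rewrite (_ : _ \o _ = id); last by apply/funext => x /=; rewrite rV_consK.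
rewrite preimage_id product_measure1E//.
by rewrite lte_mul_pinfty// ge0_fin_numE.
Qed.

HB.instance Definition _ := Measure_isSigmaFinite.Build _ _ _ lebesgue_rV_step
  lebesgue_rV_step_sigma_finite.

End step.

Fixpoint lebesgue_rV n : {sigma_finite_measure set 'rV[R]_n -> \bar R} :=
  match n with
  | 0%N => dirac (0 : 'rV[R]_0)
  | n'.+1 => lebesgue_rV_step (lebesgue_rV n')
  end.

End lebesgue_rV.
Arguments lebesgue_rV {R} n.

Section probability.
Context (R : realType) (dT : measure_display) (T : measurableType dT)
  (P : probability T R).

Definition mutually_independent (I : eqType) dE (E : measurableType dE)
    (X : I -> T -> E) : Prop :=
  forall (r : seq I) (A : I -> set E), uniq r -> (forall i, measurable (A i)) ->
    P (\bigcap_(i in [set` r]) X i @^-1` A i) =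
      (\prod_(i <- r) P (X i @^-1` A i))%E.

Definition std_normal_vector n (X : T -> 'rV[R]_n) : Prop :=
  [/\ measurable_fun [set: T] X,
      forall i (A : set (measurableTypeR R)), measurable A ->
        P ((fun w => X w ord0 i) @^-1` A) = normal_prob 0 1 A
    & mutually_independent (fun (i : 'I_n) (w : T) => X w ord0 i)].

(* [g \o Y] is a version of E[X | Y]. *)
Definition is_cond_exp dE (E : measurableType dE) (X : T -> R) (Y : T -> E)
    (g : E -> R) : Prop :=
  [/\ measurable_fun [set: E] g,
      P.-integrable [set: T] (fun w => (g (Y w))%:E)
    & forall A, measurable A ->
        (\int[P]_(w in Y @^-1` A) (g (Y w))%:E =
         \int[P]_(w in Y @^-1` A) (X w)%:E)%E].

(* The function [y |-> E[X | Y = y]]; it exists whenever [X] is integrable and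
   is determined up to a null set of the law of [Y]. *)
Definition cond_exp dE (E : measurableType dE) (X : T -> R) (Y : T -> E) :
    E -> R :=
  xget (fun=> 0) [set g | is_cond_exp X Y g].

End probability.

(* [b s y] is the state actually reached from [s] when the unconstrained step
   leads to [y]; it may differ from [y] only if the boundary is involved. *)
Definition boundary_rule (R : realType) n (S : set 'rV[R]_n)
    (b : 'rV[R]_n -> 'rV[R]_n -> 'rV[R]_n) : Prop :=
  [/\ measurable_fun [set: _] (fun sy : 'rV[R]_n * 'rV[R]_n => b sy.1 sy.2),
      forall s y, S s -> S (b s y)
    & forall s y, interior S s -> interior S y -> b s y = y].

Section chain.
Context (R : realType) (n : nat) (dT : measure_display) (T : measurableType dT)
  (P : probability T R).

Record is_chain (S : set 'rV[R]_n) (alpha : 'rV[R]_n -> 'rV[R]_n)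
    (sigma : 'rV[R]_n -> 'M[R]_n) (b : 'rV[R]_n -> 'rV[R]_n -> 'rV[R]_n)
    (eps : R) (Z s : nat -> T -> 'rV[R]_n) : Prop := {
  chain_measurable : forall m, measurable_fun [set: T] (s m);
  chain_init : forall w, S (s 0%N w);
  chain_step : forall m w, s m.+1 w =
    b (s m w) (s m w + eps *: alpha (s m w)
                     + Num.sqrt eps *: (Z m w *m (sigma (s m w))^T));
  chain_noise : forall m, std_normal_vector P (Z m);
  chain_independent :
    mutually_independent P (fun k : option nat => if k is Some m then Z m else s 0%N)
}.

Context (d : nat) (gamma : R) (rew : 'rV[R]_n -> R)
  (V : 'rV[R]_n -> 'rV[R]_d -> R).

Definition bellman_residual (s1 s2 : 'rV[R]_n) (theta : 'rV[R]_d) : R :=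
  rew s1 + gamma * V s2 theta - V s1 theta.

Context (s : nat -> T -> 'rV[R]_n) (m : nat).

Definition increment (k : nat) (w : T) : 'rV[R]_n := s k.+1 w - s k w.

Definition mean_residual (theta : 'rV[R]_d) : 'rV[R]_n -> R :=
  cond_exp P (fun w => bellman_residual (s m w) (s m.+1 w) theta) (s m).

Definition mean_residual_bff (theta : 'rV[R]_d) : 'rV[R]_n -> R :=
  cond_exp P
    (fun w => bellman_residual (s m w) (s m w + increment m.+1 w) theta) (s m).

Definition mean_residual_gap (theta : 'rV[R]_d) : 'rV[R]_n -> R :=
  cond_exp P
    (fun w => bellman_residual (s m w) (s m w + increment m.+1 w) theta
            - bellman_residual (s m w) (s m w + increment m w) theta) (s m).

Definition obj (theta : 'rV[R]_d) : R :=
  fine 'E_P[fun w => 2^-1 * mean_residual theta (s m w) ^+ 2].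

Definition obj_hat (theta : 'rV[R]_d) : R :=
  2^-1 * fine 'E_P[fun w => mean_residual theta (s m w)
                            * mean_residual_bff theta (s m w)].

Definition obj_tilde (theta : 'rV[R]_d) : R := obj_hat theta - obj theta.

Definition j_tilde (x : 'rV[R]_n) (theta : 'rV[R]_d) : R :=
  mean_residual theta x * mean_residual_gap theta x.

Definition noise_var (theta : 'rV[R]_d) : R :=
  fine (variance P (fun w => 2^-1 * mean_residual theta (s m w) ^+ 2)).

Definition noise_var_tilde (theta : 'rV[R]_d) : R :=
  fine (variance P (fun w => 2^-1 * mean_residual theta (s m w) ^+ 2
                             + j_tilde (s m w) theta))
  - noise_var theta.

End chain.

Section fokker_planck.
Context (R : realType) (d : nat).
Implicit Types (Omega : set 'rV[R]_d) (f p : 'rV[R]_d -> R)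
  (F drift : 'rV[R]_d -> 'rV[R]_d).

Definition dot (u v : 'rV[R]_d) : R := \sum_i u ord0 i * v ord0 i.

Definition grad f (x : 'rV[R]_d) : 'rV[R]_d :=
  \row_i 'D_(delta_mx ord0 i) f x.

Definition divergence F (x : 'rV[R]_d) : R :=
  \sum_i 'D_(delta_mx ord0 i) (fun y => F y ord0 i) x.

Definition hessian f (x : 'rV[R]_d) : 'M[R]_d :=
  \matrix_(i, j) 'D_(delta_mx ord0 i) (fun y => 'D_(delta_mx ord0 j) f y) x.

Definition twice_differentiable Omega f : Prop :=
  forall x, Omega x -> differentiable f x /\ differentiable (grad f) x.

Definition Linfty_norm Omega f : \bar R :=
  'N[lebesgue_rV d]_+oo[(EFin \o f) \_ Omega]%E.

Definition hessian_norm Omega f : \bar R :=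
  sqrte (\sum_i \sum_j (Linfty_norm Omega (fun x => hessian f x i j)) ^+ 2)%E.

(* [nu] is the outward unit normal of [Omega] at [x]: around [x] the boundary
   is, to first order, the hyperplane orthogonal to [nu].  There is at most one
   such vector, and none at points where the boundary has no tangent plane. *)
Definition outward_normal Omega (x nu : 'rV[R]_d) : Prop :=
  dot nu nu = 1 /\
  forall e, 0 < e -> \forall y \near x,
    (Omega y -> dot nu (y - x) <= e * `|y - x|) /\
    (~ Omega y -> - (e * `|y - x|) <= dot nu (y - x)).

Definition fp_flux drift (D eta : R) p (x : 'rV[R]_d) : 'rV[R]_d :=
  p x *: drift x + (eta / 2) *: grad (fun y => D * p y) x.

(* Classical solutions.  As no regularity up to the boundary is available, the
   boundary value of the normal flux is its limit from inside [Omega]. *)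
Definition fp_solution Omega drift (D eta : R) (p : R -> 'rV[R]_d -> R) : Prop :=
  (forall t x, 0 < t -> Omega x ->
     [/\ derivable (p^~ x) t 1,
         differentiable (p t) x,
         differentiable (fp_flux drift D eta (p t)) x
       & derive1 (p^~ x) t = divergence (fp_flux drift D eta (p t)) x]) /\
  (forall t x nu, 0 < t -> closure Omega x -> ~ Omega x ->
     outward_normal Omega x nu ->
     dot (fp_flux drift D eta (p t) y) nu @[y --> within Omega (nbhs x)]
       --> (0 : R)).

Definition probability_density Omega p : Prop :=
  [/\ measurable_fun Omega p,
      forall x, Omega x -> 0 <= p x
    & (\int[lebesgue_rV d]_(x in Omega) (p x)%:E = 1)%E].

Definition steady_state Omega drift (D eta : R) p : Prop :=
  probability_density Omega p /\ fp_solution Omega drift D eta (fun=> p).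

Definition gibbs_const Omega (beta : R) f : R :=
  \int[lebesgue_rV d]_(x in Omega) expR (- (beta * f x)).

Definition gibbs Omega (beta : R) f (x : 'rV[R]_d) : R :=
  (gibbs_const Omega beta f)^-1 * expR (- (beta * f x)).

End fokker_planck.

(* [g eps x = O(h eps)] as [eps] decreases to 0, uniformly in [x] in [A]. *)
Definition unif_bigO (R : realType) (X : Type) (W : normedZmodType R)
    (A : set X) (g : R -> X -> W) (h : R -> R) : Prop :=
  exists K : R, \forall eps \near 0^'+, forall x, A x -> `|g eps x| <= K * h eps.

(* Main.v *)
Require Import Defs.
From HB Require Import structures.
From mathcomp Require Import all_boot all_order all_algebra.
From mathcomp Require Import all_classical all_reals all_analysis.
From mathcomp Require Import measurable_realfun ess_sup_inf ring lra.

Set Implicit Arguments.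
Unset Strict Implicit.

Import Order.TTheory GRing.Theory Num.Theory.
Import numFieldNormedType.Exports.

Local Open Scope classical_set_scope.
Local Open Scope ring_scope.

(** The argument has three ingredients.

    Stationarity.  With [beta = 2 / (eta D)] a Gibbs density [p] satisfies
    [(eta / 2) grad (D p) = - p grad f], so the flux [p grad f + (eta / 2)
    grad (D p)] vanishes identically on [Omega] ([gibbs_flux_eq0]).  Both the
    equation and the no-flux boundary condition follow at once
    ([gibbs_steady_state]).  This applies to [J] and to [J + J~], whose gradient
    is the sum of the gradients.

    Normalizability.  The normalizing constants have to be finite and positive
    for every inverse temperature, while integrability of [exp (- J)] only
    concerns the inverse temperature 1.  What gives it is that [J] and its
    biased version are bounded: the Bellman residual is bounded, a version of
    the conditional expectation of a bounded variable is almost surely bounded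
    by the same constant ([cond_exp_bounded_ae]), hence so are the objectives
    ([obj_bounded], [obj_hat_bounded]).  Moreover [Omega], being nonempty, open
    and bounded, has positive finite Lebesgue measure
    ([lebesgue_rV_open_gt0], [lebesgue_rV_bounded_ltoo]).

    Comparison.  If the exponents [beta f] and [beta' g] differ by at most [L],
    the normalizing constants differ by a factor at most [exp L], and so do the
    unnormalized densities; the ratio of the densities is thus at most
    [exp (2 L)] ([gibbs_ratio_le]).  Here
    [J / Sigma - (J + J~) / (Sigma + Sigma~)] is, up to bounded factors,
    a combination of [Sigma~] and [J~], both of order [eps ^ 2]; with the
    prefactor [2 / eta], [L] is of order [eps ^ 2 / eta]
    ([gibbs_exponent_diff]), and [exp (2 L) <= 1 + 4 L] once [2 L <= 1 / 2]. *)

(** * Lebesgue measure of open and of bounded sets of row vectors *)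

Lemma measurable_rV_ball (R : realType) (n : nat) (c : 'rV[R]_n) (r : R) :
  measurable (ball c r).
Proof.
have [r0|r0] := ltP 0 r; last first.
  rewrite (_ : ball c r = set0)//; apply/seteqP; split=> // v [].
  by rewrite ltNge r0.
have -> : ball c r =
    \bigcap_(i in [set` finset.setT]) ((fun v : 'rV[R]_n => v ord0 i) @^-1` ball (c ord0 i) r).
  apply/seteqP; split => v /=; first by move=> [_ cv] i _; exact: cv.
  by move=> cv; split=> // i j; rewrite [i]ord1; apply: cv; rewrite /= inE.
apply: fin_bigcap_measurable => // i _.
rewrite -[X in measurable X]setTI.
by apply: measurable_rV_coord => //; exact: measurable_ball.
Qed.

(** The sigma-algebra is generated by the coordinates, so it contains the balls
    of the max norm; an open set is the union of the countably many balls with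
    rational centre and radius [1 / k.+1] that it contains. *)
Lemma open_rV_measurable (R : realType) (n : nat) (A : set 'rV[R]_n) :
  open A -> measurable A.
Proof.
move=> oA.
pose F (qk : 'rV[rat]_n * nat) : set 'rV[R]_n :=
  let B := ball (map_mx ratr qk.1 : 'rV[R]_n) (qk.2.+1%:R^-1) in
  if pselect (B `<=` A) then B else set0.
have -> : A = \bigcup_qk F qk.
  apply/seteqP; split => [v Av|v [qk _]]; last first.
    by rewrite /F; case: pselect => //= BA; exact: BA.
  have /nbhs_ballP[e /= e0 eA] : nbhs v A by exact: open_nbhs_nbhs.
  (* A ball of radius [r] around a point at distance less than [r] from [v]
     stays within [2 r <= e] of [v]. *)
  pose k := Num.truncn (2 / e); pose r : R := k.+1%:R^-1.
  have r0 : 0 < r by rewrite invr_gt0.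
  have re : r + r <= e.
    have ek : 2 / e < k.+1%:R by exact: archimedean.Num.Theory.truncnS_gt.
    rewrite -mulr2n -mulr_natl /r ler_pdivrMr ?ltr0Sn// mulrC ltW//.
    by rewrite -ltr_pdivrMr.
  have qP i : exists q : rat, ball (ratr q : R) r (v ord0 i).
    have [|q] := @rat_in_itvoo R (v ord0 i - r) (v ord0 i + r); first lra.
    rewrite in_itv/= => /andP[q1 q2]; exists q.
    by rewrite /ball/= ltr_norml; apply/andP; split; lra.
  pose q : 'rV[rat]_n := \row_i xchoose (qP i).
  have qv : ball (map_mx ratr q : 'rV[R]_n) r v.
    by split=> // i j; rewrite [i]ord1 !mxE; exact: (xchooseP (qP j)).
  exists (q, k) => //; rewrite /F; case: pselect => //= -[].
  move=> w qw; apply: eA; apply: (le_ball re).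
  exact: ball_triangle (ball_sym qv) qw.
apply: countable_bigcupT_measurable => [|qk]; first exact: countableP.
by rewrite /F; case: pselect => /= _; [exact: measurable_rV_ball|].
Qed.

(** A ball of the max norm is a cube of side [2 r]: under [rV_cons] it is the
    product of an interval and of a cube of one dimension less. *)
Lemma lebesgue_rV_ball (R : realType) (n : nat) (c : 'rV[R]_n) (r : R) :
  0 < r -> lebesgue_rV n (ball c r) = ((r *+ 2) ^+ n)%:E.
Proof.
move=> r0; elim: n c => [|n IH] c.
  rewrite expr0 /= /dirac/= indicE mem_set//.
  by split=> // i [].
pose c' : 'rV[R]_n := \row_i c ord0 (lift ord0 i).
rewrite /= /lebesgue_rV_step /pushforward.
have -> : @rV_cons R n @^-1` ball c r = ball (c ord0 ord0) r `*` ball c' r.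
  apply/seteqP; split => -[x v] /=.
    move=> [_ cv]; split.
      by have := cv ord0 ord0; rewrite !mxE unlift_none.
    split=> // i j; have := cv ord0 (lift ord0 j).
    by rewrite [i]ord1 !mxE liftK.
  move=> [cx [_ cv]]; split=> // i j; rewrite [i]ord1 mxE.
  case: unliftP => [k ->|->] //=.
  by have := cv ord0 k; rewrite mxE.
rewrite product_measure1E; [|exact: measurable_ball|exact: measurable_rV_ball].
by rewrite IH exprS EFinM -(lebesgue_measure_ball (c ord0 ord0) (ltW r0)).
Qed.

Lemma lebesgue_rV_open_gt0 (R : realType) (n : nat) (A : set 'rV[R]_n) :
  open A -> A !=set0 -> (0 < lebesgue_rV n A)%E.
Proof.
move=> oA [x Ax]; have /nbhs_ballP[e /= e0 eA] : nbhs x A by exact: open_nbhs_nbhs.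
apply: (@lt_le_trans _ _ (lebesgue_rV n (ball x e))).
  by rewrite lebesgue_rV_ball// lte_fin exprn_gt0// pmulrn_lgt0.
apply: le_measure => //; rewrite inE; first exact: measurable_rV_ball.
exact: open_rV_measurable.
Qed.

Lemma lebesgue_rV_bounded_ltoo (R : realType) (n : nat) (A : set 'rV[R]_n) :
  measurable A -> bounded_set A -> (lebesgue_rV n A < +oo)%E.
Proof.
move=> mA /pinfty_ex_gt0 [M M0 AM].
apply: (@le_lt_trans _ _ (lebesgue_rV n (ball (0 : 'rV[R]_n) (M + 1)))).
  apply: le_measure => //; rewrite ?inE//; first exact: measurable_rV_ball.
  move=> x Ax; rewrite mx_norm_ball /ball_/= sub0r normrN.
  by have /= := AM x Ax; lra.
by rewrite lebesgue_rV_ball ?ltry// addr_gt0.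
Qed.

(** * Conditional expectations of bounded variables *)

(** On [A = {K < g}] the defining property of [g] gives
    [\int_(Y^-1 A) (g (Y) - K) = \int_(Y^-1 A) (X - K) <= 0], although the left
    integrand is positive there; so [Y^-1 A] is negligible. *)
Lemma is_cond_exp_le_ae (R : realType) (dT : measure_display)
    (T : measurableType dT) (P : probability T R) (dE : measure_display)
    (E : measurableType dE) (X : T -> R) (Y : T -> E) (g : E -> R) (K : R) :
  measurable_fun setT X -> measurable_fun setT Y ->
  (forall w, `|X w| <= K) -> is_cond_exp P X Y g ->
  {ae P, forall w, g (Y w) <= K}.
Proof.
move=> mX mY XK [mg ig Hg].
pose A := [set y | K < g y].
have mA : measurable A.
  rewrite (_ : A = g @^-1` `]K, +oo[%classic).
    by rewrite -[X in measurable X]setTI; apply: mg => //; exact: measurable_itv.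
  by apply/seteqP; split => y /=; rewrite in_itv/= andbT.
have mB : measurable (Y @^-1` A) by rewrite -[X in measurable X]setTI; exact: mY.
have iX : P.-integrable (Y @^-1` A) (EFin \o X).
  apply: measurable_bounded_integrable => //.
  - by rewrite -ge0_fin_numE// fin_num_measure.
  - exact: measurable_funS mX.
  - by exists K; split; [exact: num_real|move=> M /ltW KM w _ /=; exact: le_trans KM].
have igA : P.-integrable (Y @^-1` A) (EFin \o (g \o Y)).
  exact: integrableS ig.
have ik : P.-integrable (Y @^-1` A) (EFin \o cst K).
  exact: finite_measure_integrable_cst.
have le0 : (\int[P]_(w in Y @^-1` A) `|(g (Y w))%:E - K%:E| <= 0)%E.
  under eq_integral => w.
    by rewrite inE => Kg; rewrite gee0_abs ?sube_ge0 ?lee_fin ?ltW//; over.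
  rewrite integralB// Hg// -integralB//.
  have iXK := integrableB mB iX ik.
  rewrite -[leRHS](@integral0 _ _ _ P (Y @^-1` A)).
  apply: le_integral => //; first exact: integrable0.
  by move=> w _; rewrite /= lee_fin subr_le0 (le_trans (ler_norm _)).
have eq0 : (\int[P]_(w in Y @^-1` A) `|(g (Y w))%:E - K%:E| = 0)%E.
  by apply/eqP; rewrite eq_le le0 integral_ge0.
have mf : measurable_fun (Y @^-1` A) (fun w => (g (Y w))%:E - K%:E)%E.
  by have := integrableB mB igA ik; exact: measurable_int.
have /(ae_eq_integral_abs P mB mf) := eq0.
apply: filterS => w /= Hw; rewrite leNgt; apply/negP => Kg.
by have := Hw Kg; rewrite -EFinB => -[] /eqP; rewrite subr_eq0 gt_eqF.
Qed.

(** Turns the upper bound of [is_cond_exp_le_ae] into a lower bound. *)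
Lemma is_cond_expN (R : realType) (dT : measure_display)
    (T : measurableType dT) (P : probability T R) (dE : measure_display)
    (E : measurableType dE) (X : T -> R) (Y : T -> E) (g : E -> R) :
  measurable_fun setT Y -> P.-integrable setT (EFin \o X) ->
  is_cond_exp P X Y g -> is_cond_exp P (\- X) Y (\- g).
Proof.
move=> mY iX [mg ig Hg].
have integralNE (h : T -> R) A : measurable A -> P.-integrable setT (EFin \o h) ->
    (\int[P]_(w in Y @^-1` A) (- h w)%:E = - \int[P]_(w in Y @^-1` A) (h w)%:E)%E.
  move=> mA ih; rewrite -integralN.
    by apply: eq_integral => w _; rewrite EFinN.
  have mYA : measurable (Y @^-1` A).
    by rewrite -[X in measurable X]setTI; exact: mY.
  exact/(integrable_add_def mYA)/(integrableS measurableT mYA _ ih).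
split.
- exact: measurableT_comp.
- by have := integrableN ig; apply: eq_integrable => //= w _; rewrite EFinN.
- by move=> A mA; rewrite !integralNE// Hg.
Qed.

Lemma cond_exp_measurable (R : realType) (dT : measure_display)
    (T : measurableType dT) (P : probability T R) (dE : measure_display)
    (E : measurableType dE) (X : T -> R) (Y : T -> E) :
  measurable_fun setT (cond_exp P X Y).
Proof. by rewrite /cond_exp; case: xgetP => [g _ []//|_]; exact: measurable_cst. Qed.

(** Existence of a conditional expectation is not at stake: in its absence
    [cond_exp] takes the default value 0, which satisfies the same bound. *)
Lemma cond_exp_bounded_ae (R : realType) (dT : measure_display)
    (T : measurableType dT) (P : probability T R) (dE : measure_display)
    (E : measurableType dE) (X : T -> R) (Y : T -> E) (K : R) :
  measurable_fun setT X -> measurable_fun setT Y ->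
  0 <= K -> (forall w, `|X w| <= K) ->
  {ae P, forall w, `|cond_exp P X Y (Y w)| <= K}.
Proof.
move=> mX mY K0 XK; rewrite /cond_exp; case: xgetP => [g _ gXY|_]; last first.
  by apply: nearW => w; rewrite normr0.
have iX : P.-integrable setT (EFin \o X).
  apply: measurable_bounded_integrable => //.
  - by rewrite -ge0_fin_numE// fin_num_measure.
  - by exists K; split; [exact: num_real|move=> M /ltW KM w _ /=; exact: le_trans KM].
have ub := is_cond_exp_le_ae mX mY XK gXY.
have lb : {ae P, forall w, - g (Y w) <= K}.
  apply: (is_cond_exp_le_ae _ mY _ (is_cond_expN mY iX gXY)).
    exact: measurableT_comp.
  by move=> w; rewrite normrN.
by apply: filterS2 ub lb => w ub lb; rewrite ler_norml; apply/andP; split; lra.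
Qed.

Lemma fine_expectation_bounded (R : realType) (dT : measure_display)
    (T : measurableType dT) (P : probability T R) (X : T -> R) (K : R) :
  measurable_fun setT X -> 0 <= K -> {ae P, forall w, `|X w| <= K} ->
  `|fine 'E_P[X]| <= K.
Proof.
move=> mX K0 XK.
have EK : (`|'E_P[X]| <= K%:E)%E.
  rewrite unlock; apply: (le_trans (le_abse_integral _ measurableT _)).
    exact/measurable_EFinP.
  rewrite -[leRHS]mule1 -(probability_setT P) -integral_cst//.
  apply: ae_ge0_le_integral => //.
  - by apply: measurableT_comp => //; exact/measurable_EFinP.
  - by apply: filterS XK => w XK _ /=; rewrite lee_fin.
by move: EK; case: ('E_P[X])%E => [r| |] //=; rewrite ?lee_fin// normr0.
Qed.

(** * Gibbs densities of bounded potentials *)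

Section gibbs_density.
Context (R : realType) (d : nat) (Omega : set 'rV[R]_d).
Hypotheses (mOmega : measurable Omega) (Omega_gt0 : (0 < lebesgue_rV d Omega)%E)
  (Omega_fin : (lebesgue_rV d Omega < +oo)%E).

Lemma gibbs_weight_integrable (beta B : R) (f : 'rV[R]_d -> R) :
  measurable_fun Omega f -> (forall x, Omega x -> `|f x| <= B) ->
  (lebesgue_rV d).-integrable Omega (EFin \o (fun x => expR (- (beta * f x)))).
Proof.
move=> mf fB; apply: measurable_bounded_integrable => //.
  apply: measurableT_comp => //; apply: measurableT_comp => //.
  exact: measurable_funM.
exists (expR (`|beta| * B)); split; first exact: num_real.
move=> M /ltW BM x Ox /=; apply: le_trans BM.
rewrite ger0_norm ?expR_ge0// ler_expR (le_trans (ler_norm _))//.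
by rewrite normrN normrM ler_wpM2l// fB.
Qed.

Lemma gibbs_const_gt0 (beta B : R) (f : 'rV[R]_d -> R) :
  measurable_fun Omega f -> (forall x, Omega x -> `|f x| <= B) ->
  0 < gibbs_const Omega beta f.
Proof.
move=> mf fB; have := gibbs_weight_integrable beta mf fB.
set w := fun x => _ => iw.
apply: (@lt_le_trans _ _ (\int[lebesgue_rV d]_(x in Omega) expR (- (`|beta| * B)))).
  rewrite Rintegral_cst// mulr_gt0 ?expR_gt0//.
  by rewrite fine_gt0// Omega_gt0.
apply: le_Rintegral => //.
  apply: measurable_bounded_integrable => //.
  exists (expR (- (`|beta| * B))); split; first exact: num_real.
  by move=> M /ltW BM x Ox /=; rewrite ger0_norm ?expR_ge0.
move=> x Ox; rewrite ler_expR lerN2 (le_trans (ler_norm _))//.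
by rewrite normrM ler_wpM2l// fB.
Qed.

Lemma gibbs_probability_density (beta B : R) (f : 'rV[R]_d -> R) :
  measurable_fun Omega f -> (forall x, Omega x -> `|f x| <= B) ->
  probability_density Omega (gibbs Omega beta f).
Proof.
move=> mf fB; have Z0 := gibbs_const_gt0 beta mf fB.
have iw := gibbs_weight_integrable beta mf fB.
split.
- apply: measurable_funM => //.
  by have /measurable_int/measurable_EFinP := iw.
- by move=> x _; rewrite mulr_ge0 ?expR_ge0// invr_ge0 ltW.
- under eq_integral do rewrite EFinM.
  rewrite integralZl// -[X in (_ * X)%E]fineK ?integrable_fin_num//.
  by rewrite -EFinM mulVf// gt_eqF.
Qed.

(** The pointwise weights [exp (- beta f)] and [exp (- beta' g)] are within a
    factor [exp L] of each other; integrating, so are the normalizing constants.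
    The two factors multiply in the ratio of the normalized densities. *)
Lemma gibbs_ratio_le (beta beta' B B' L : R) (f g : 'rV[R]_d -> R) :
  measurable_fun Omega f -> (forall x, Omega x -> `|f x| <= B) ->
  measurable_fun Omega g -> (forall x, Omega x -> `|g x| <= B') ->
  (forall x, Omega x -> `|beta * f x - beta' * g x| <= L) ->
  forall x, Omega x ->
    0 <= gibbs Omega beta' g x / gibbs Omega beta f x <= expR (L *+ 2).
Proof.
move=> mf fB mg gB fgL x Ox.
have Zf := gibbs_const_gt0 beta mf fB; have Zg := gibbs_const_gt0 beta' mg gB.
have ZfZg : gibbs_const Omega beta f <= expR L * gibbs_const Omega beta' g.
  rewrite /gibbs_const -RintegralZl//; last exact: (gibbs_weight_integrable _ mg gB).
  apply: le_Rintegral => //; first exact: (gibbs_weight_integrable _ mf fB).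
    have := integrableZl mOmega (expR L) (gibbs_weight_integrable beta' mg gB).
    by apply: eq_integrable.
  move=> y Oy; rewrite -expRD ler_expR.
  by have := fgL y Oy; rewrite ler_norml => /andP[]; lra.
rewrite /gibbs invfM invrK -expRN opprK.
apply/andP; split.
  by rewrite !mulr_ge0 ?expR_ge0// ?invr_ge0 ltW.
have -> : (gibbs_const Omega beta' g)^-1 * expR (- (beta' * g x)) *
    (gibbs_const Omega beta f * expR (beta * f x)) =
    gibbs_const Omega beta f / gibbs_const Omega beta' g *
    expR (beta * f x - beta' * g x) by rewrite expRD; ring.
rewrite mulr2n (expRD L L) ler_pM ?expR_ge0 ?divr_ge0 ?(ltW Zf) ?(ltW Zg)//.
  by rewrite ler_pdivrMr.
by rewrite ler_expR (le_trans (ler_norm _)) ?fgL.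
Qed.

End gibbs_density.

Lemma Linfty_norm_le (R : realType) (d : nat) (Omega : set 'rV[R]_d)
    (f : 'rV[R]_d -> R) (K : R) :
  0 <= K -> (forall x, Omega x -> `|f x| <= K) ->
  (Linfty_norm Omega f <= K%:E)%E.
Proof.
move=> K0 fK; rewrite /Linfty_norm unlock; case: ifP => _ //.
apply/ess_supP; apply: nearW => x /=; rewrite patchE.
by case: ifPn => [|_]; rewrite ?inE /= ?normr0 ?lee_fin//; exact: fK.
Qed.

(** * Stationarity of Gibbs densities *)

Lemma derive_gibbs_weight (R : realType) (V : normedModType R)
    (beta k : R) (f : V -> R) (x v : V) :
  differentiable f x ->
  differentiable (fun y => k * expR (- (beta * f y))) x /\
  'D_v (fun y => k * expR (- (beta * f y))) x =
    - (beta * (k * expR (- (beta * f x)))) * 'D_v f x.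
Proof.
move=> df; pose e (t : R) : R := k * expR (- (beta * t)).
have De (t : R) : is_derive t 1 e (- (beta * e t)).
  rewrite (_ : e = cst k * (expR \o (cst (- beta) * id))); last first.
    by apply/funext => s; rewrite /e !fctE mulNr.
  apply: is_derive_eq.
  rewrite !fctE /GRing.scale/= mulNr; ring.
have de (t : R) : differentiable e t by apply/derivable1_diffP; exact: ex_derive.
have dc : differentiable (e \o f) x by exact: differentiable_comp.
split; first exact: dc.
rewrite [LHS](deriveE v dc) diff_comp//= diff1E//= derive1E derive_val deriveE//.
by rewrite /GRing.scale/= mulrC.
Qed.

(** Makes the regularity required of the flux free: a flux that vanishes on an
    open set is differentiable there, whatever the regularity of the drift. *)
Lemma near0_differentiable (R : numFieldType) (V W : normedModType R)
    (F : V -> W) (x : V) :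
  (\forall y \near x, F y = 0) -> differentiable F x.
Proof.
move=> F0; have Fx0 : F x = 0 by exact: nbhs_singleton F0.
have oF : F \o shift x = cst (F x) + \0 +o_ 0 id.
  apply/eqaddoP => _/posnumP[e]; near=> h.
  have -> : (F \o shift x - (cst (F x) + \0)) h = 0.
    rewrite !fctE Fx0 addr0 subr0; near: h.
    by move: F0; rewrite (near_shift 0) subr0.
  by rewrite normr0 mulr_ge0.
have d0 : 'd F x = \0 :> (V -> W).
  by apply: diff_unique; [exact: cst_continuous|].
apply/diff_locallyP; rewrite d0; split; [exact: cst_continuous|exact: oF].
Unshelve. all: by end_near. Qed.

(** The value [2 / (eta * D)] of the inverse temperature is exactly the one for
    which the diffusive part [(eta / 2) grad (D p) = - (eta / 2) beta D p grad f]
    cancels the drift part [p grad f]: detailed balance. *)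
Lemma gibbs_flux_eq0 (R : realType) (d : nat) (Omega : set 'rV[R]_d)
    (D eta : R) (f : 'rV[R]_d -> R) (drift : 'rV[R]_d -> 'rV[R]_d)
    (x : 'rV[R]_d) :
  D != 0 -> eta != 0 -> differentiable f x -> drift x = grad f x ->
  fp_flux drift D eta (gibbs Omega (2 / (eta * D)) f) x = 0.
Proof.
move=> D0 eta0 df driftE; rewrite /fp_flux driftE; set beta := 2 / (eta * D).
set p := gibbs _ _ _.
have -> : grad (fun y => D * p y) x = - (beta * (D * p x)) *: grad f x.
  apply/rowP => i; rewrite !mxE.
  pose k := D * (gibbs_const Omega beta f)^-1.
  have pE y : D * p y = k * expR (- (beta * f y)) by rewrite mulrA.
  rewrite pE (_ : (fun y => D * p y) = fun y => k * expR (- (beta * f y))).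
    exact: (derive_gibbs_weight beta k (delta_mx ord0 i) df).2.
  by apply/funext.
rewrite scalerA -scalerDl (_ : _ + _ = 0) ?scale0r// /beta; field.
by rewrite D0 eta0.
Qed.

Lemma gibbs_steady_state (R : realType) (d : nat) (Omega : set 'rV[R]_d)
    (D eta : R) (f : 'rV[R]_d -> R) (drift : 'rV[R]_d -> 'rV[R]_d) :
  open Omega -> 0 < D -> 0 < eta ->
  (forall x, Omega x -> differentiable f x) ->
  (forall x, Omega x -> drift x = grad f x) ->
  probability_density Omega (gibbs Omega (2 / (eta * D)) f) ->
  steady_state Omega drift D eta (gibbs Omega (2 / (eta * D)) f).
Proof.
move=> oOmega D0 eta0 df driftE pd; split=> //.
have flux0 y : Omega y -> fp_flux drift D eta (gibbs Omega (2 / (eta * D)) f) y = 0.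
  by move=> Oy; apply: gibbs_flux_eq0; rewrite ?gt_eqF//; [exact: df|exact: driftE].
split=> [t x t0 Ox|t x nu t0 _ _ _].
  have near0 : \forall y \near x,
      fp_flux drift D eta (gibbs Omega (2 / (eta * D)) f) y = 0.
    by apply: filterS (open_nbhs_nbhs (conj oOmega Ox)) => y /flux0.
  split.
  - exact: derivable_cst.
  - exact: (derive_gibbs_weight _ _ 0 (df x Ox)).1.
  - exact: near0_differentiable.
  - rewrite derive1_cst /divergence big1// => i _.
    transitivity ('D_(delta_mx ord0 i : 'rV[R]_d) (cst (0 : R)) x).
      by apply: near_eq_derive; apply: filterS near0 => y ->; rewrite mxE.
    exact: derive_cst.
apply: (@cvg_trans _ (cst 0 @ within Omega (nbhs x))); last exact: cvg_cst.
apply: near_eq_cvg; apply: filterS (withinT Omega (nbhs_filter x)) => y Oy.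
by rewrite flux0// /dot big1// => i _; rewrite mxE mul0r.
Qed.

(** * Boundedness of the objectives *)

Section objective_bounds.
Context (R : realType) (n d : nat) (dT : measure_display) (T : measurableType dT)
  (P : probability T R) (gamma : R) (rew : 'rV[R]_n -> R)
  (V : 'rV[R]_n -> 'rV[R]_d -> R) (theta : 'rV[R]_d) (Br Bv : R).
Hypotheses (gamma01 : 0 < gamma < 1) (mrew : measurable_fun setT rew)
  (mV : measurable_fun setT (V^~ theta)) (rewB : forall x, `|rew x| <= Br)
  (VB : forall x, `|V x theta| <= Bv).

Lemma bellman_residual_measurable (X Y : T -> 'rV[R]_n) :
  measurable_fun setT X -> measurable_fun setT Y ->
  measurable_fun setT (fun w => bellman_residual gamma rew V (X w) (Y w) theta).
Proof.
move=> mX mY; apply: measurable_funB; last exact: (measurableT_comp mV).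
apply: measurable_funD; first exact: (measurableT_comp mrew).
by apply: measurable_funM => //; exact: (measurableT_comp mV).
Qed.

Lemma bellman_residual_bounded (x y : 'rV[R]_n) :
  `|bellman_residual gamma rew V x y theta| <= Br + Bv *+ 2.
Proof.
have /andP[g0 g1] := gamma01.
rewrite /bellman_residual (le_trans (ler_normB _ _))// mulr2n addrA lerD//.
rewrite (le_trans (ler_normD _ _))// lerD// normrM gtr0_norm//.
apply: le_trans (VB y).
by apply: ler_piMl; rewrite ?normr_ge0 ?ltW.
Qed.

Let K := Br + Bv *+ 2.

Let K_ge0 : 0 <= K.
Proof. exact: le_trans (normr_ge0 _) (bellman_residual_bounded 0 0). Qed.

Context (s : nat -> T -> 'rV[R]_n) (m : nat).
Hypothesis ms : forall k, measurable_fun setT (s k).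

Lemma measurable_shifted_state :
  measurable_fun setT (fun w => s m w + increment s m.+1 w).
Proof.
have mc k i := measurableT_comp (@measurable_rV_coord R n i) (ms k).
apply: measurable_fun_rVP => i.
rewrite (_ : (fun _ => _) =
    fun w => s m w ord0 i + (s m.+2 w ord0 i - s m.+1 w ord0 i)).
  by apply: measurable_funD; [exact: mc|apply: measurable_funB; exact: mc].
by apply/funext => w; rewrite !mxE.
Qed.

Let mean_bounded :
  {ae P, forall w, `|mean_residual P gamma rew V s m theta (s m w)| <= K}.
Proof.
apply: cond_exp_bounded_ae => // [|w]; last exact: bellman_residual_bounded.
exact: bellman_residual_measurable.
Qed.

Let mean_bff_bounded :
  {ae P, forall w, `|mean_residual_bff P gamma rew V s m theta (s m w)| <= K}.
Proof.
apply: cond_exp_bounded_ae => // [|w]; last exact: bellman_residual_bounded.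
by apply: bellman_residual_measurable => //; exact: measurable_shifted_state.
Qed.

Lemma obj_bounded : `|obj P gamma rew V s m theta| <= 2^-1 * K ^+ 2.
Proof.
apply: fine_expectation_bounded.
- apply: measurable_funM => //; apply: measurable_funX.
  exact: (measurableT_comp (cond_exp_measurable _ _ _)).
- by rewrite mulr_ge0// exprn_ge0.
- apply: filterS mean_bounded => w bw.
  by rewrite normrM gtr0_norm// ler_wpM2l// normrX lerXn2r// nnegrE.
Qed.

Lemma obj_hat_bounded : `|obj_hat P gamma rew V s m theta| <= 2^-1 * K ^+ 2.
Proof.
rewrite /obj_hat normrM gtr0_norm// ler_wpM2l//.
apply: fine_expectation_bounded.
- by apply: measurable_funM; exact: (measurableT_comp (cond_exp_measurable _ _ _)).
- by rewrite exprn_ge0.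
- apply: filterS2 mean_bounded mean_bff_bounded => w b1 b2.
  by rewrite normrM expr2 ler_pM.
Qed.

End objective_bounds.

(** * Quantitative comparison of the two exponents *)

Lemma near_right0_ex (R : realType) (Q : R -> Prop) :
  (\forall e \near 0^'+, Q e) ->
  exists2 delta : R, 0 < delta & forall e, 0 < e < delta -> Q e.
Proof.
move=> /nbhs_ballP[r /= r0 rQ]; exists r => // e /andP[e0 er].
by apply: rQ => //; rewrite /ball/= sub0r normrN gtr0_norm.
Qed.

Lemma unif_bigO_ex (R : realType) (X : Type) (W : normedZmodType R)
    (A : set X) (g : R -> X -> W) (h : R -> R) : (forall e, 0 <= h e) ->
  unif_bigO A g h -> exists K delta : R, [/\ 0 <= K, 0 < delta &
    forall e x, 0 < e < delta -> A x -> `|g e x| <= K * h e].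
Proof.
move=> h0 [K /near_right0_ex[r r0 rP]]; exists `|K|, r; split=> // e x er Ax.
by rewrite (le_trans (rP _ er _ Ax))// ler_wpM2r// ler_norm.
Qed.

(** From [exp (- x) >= 1 - x] one gets [exp x <= 1 / (1 - x)], and
    [1 <= (1 + 2 x) (1 - x)] on [0, 1 / 2]. *)
Lemma expR_le_affine (R : realType) (x : R) :
  0 <= x -> x <= 2^-1 -> expR x <= 1 + 2 * x.
Proof.
move=> x0 x1; have := expR_ge1Dx (- x); have := expRxMexpNx_1 x.
have := expR_gt0 x; set a := expR x; set b := expR (- x) => a0 ab xb.
have ax1 : a * (1 - x) <= 1 by rewrite -[leRHS]ab ler_pM2l.
have x1' : 0 < 1 - x by lra.
rewrite -(ler_pM2r x1') (le_trans ax1)//.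
have : 0 <= x * (1 - 2 * x) by rewrite mulr_ge0//; lra.
by nra.
Qed.

(** Rests on the identity
    [f / u - g / v = (f (v - u) / u - (g - f)) / v]. The potential [f] itself is
    only bounded, but it comes multiplied by the small difference [v - u]. *)
Lemma gibbs_exponent_diff (R : realFieldType) (eta u v c B a b f g : R) :
  0 < eta -> 0 < c -> c <= u -> c / 2 <= v ->
  `|f| <= B -> `|g - f| <= a -> `|v - u| <= b ->
  `|2 / (eta * u) * f - 2 / (eta * v) * g| <= 4 * (a / c + B * b / c ^+ 2) / eta.
Proof.
move=> eta0 c0 cu cv fB gfa vub.
have u0 : 0 < u by lra.
have v0 : 0 < v by lra.
have -> : 2 / (eta * u) * f - 2 / (eta * v) * g =
    (2 / eta) * (v^-1 * (u^-1 * (f * (v - u)) - (g - f))).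
  by field; rewrite !gt_eqF.
have -> : 4 * (a / c + B * b / c ^+ 2) / eta =
    (2 / eta) * ((c / 2)^-1 * (c^-1 * (B * b) + a)).
  by field; rewrite !gt_eqF.
have normV (w : R) : 0 < w -> `|w^-1| = w^-1 by move=> w0; rewrite gtr0_norm ?invr_gt0.
have leV (w w' : R) : 0 < w -> w <= w' -> w'^-1 <= w^-1.
  by move=> w0 ww'; rewrite lef_pV2 ?posrE// (lt_le_trans w0).
rewrite normrM gtr0_norm ?divr_gt0// ler_pM2l ?divr_gt0// normrM normV//.
apply: ler_pM => //; [by rewrite invr_ge0 ltW|exact: leV (divr_gt0 c0 _) cv|].
apply: le_trans (ler_normB _ _) _; apply: lerD => //.
rewrite normrM normV// normrM.
apply: ler_pM; [by rewrite invr_ge0 ltW|by rewrite mulr_ge0|exact: leV|].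
exact: ler_pM.
Qed.

(** * Steady states and their ratio *)

Unset Implicit Arguments.
Set Strict Implicit.

Theorem theorem3 (R : realType)
    (* the chain *)
    (n : nat) (S : set 'rV[R]_n) (hS : compact S)
    (alpha : 'rV[R]_n -> 'rV[R]_n) (sigma : 'rV[R]_n -> 'M[R]_n)
    (halpha : measurable_fun [set: 'rV[R]_n] alpha)
    (hsigma : forall i, measurable_fun [set: 'rV[R]_n] (fun x => row i (sigma x)))
    (b : 'rV[R]_n -> 'rV[R]_n -> 'rV[R]_n) (hb : boundary_rule S b)
    (dT : measure_display) (T : measurableType dT) (P : probability T R)
    (eps0 : R) (heps0 : 0 < eps0)
    (Z s : R -> nat -> T -> 'rV[R]_n)
    (hchain : forall eps : R, 0 < eps < eps0 ->
       is_chain P S alpha sigma b eps (Z eps) (s eps))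
    (m : nat)
    (* parameters, reward, value function *)
    (d : nat) (Omega : set 'rV[R]_d)
    (Omega_ne : Omega !=set0) (Omega_open : open Omega)
    (Omega_bounded : bounded_set Omega) (Omega_connected : connected Omega)
    (gamma : R) (hgamma : 0 < gamma < 1)
    (rew : 'rV[R]_n -> R) (V : 'rV[R]_n -> 'rV[R]_d -> R)
    (rew_measurable : measurable_fun [set: 'rV[R]_n] rew)
    (V_measurable : forall theta, Omega theta ->
       measurable_fun [set: 'rV[R]_n] (V^~ theta))
    (rew_bounded : exists B : R, forall x, `|rew x| <= B)
    (V_bounded : exists B : R, forall x theta, Omega theta -> `|V x theta| <= B) :
  let J := fun eps => obj P gamma rew V (s eps) m in
  let Jhat := fun eps => obj_hat P gamma rew V (s eps) m in
  let Jtilde := fun eps => obj_tilde P gamma rew V (s eps) m in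
  let Sig := fun eps => noise_var P gamma rew V (s eps) m in
  let Sigtilde := fun eps => noise_var_tilde P gamma rew V (s eps) m in
  (* standing assumptions *)
  (forall eps : R, 0 < eps < eps0 ->
     twice_differentiable Omega (J eps) /\ twice_differentiable Omega (Jhat eps)) ->
  unif_bigO Omega Jtilde (fun eps => eps ^+ 2) ->
  unif_bigO Omega (fun eps => grad (Jtilde eps)) (fun eps => eps ^+ 2) ->
  unif_bigO Omega Sigtilde (fun eps => eps ^+ 2) ->
  (forall eps : R, 0 < eps < eps0 ->
     (lebesgue_rV d).-integrable Omega (fun theta => (expR (- J eps theta))%:E) /\
     (lebesgue_rV d).-integrable Omega (fun theta => (expR (- Jhat eps theta))%:E)) ->
  (exists M : R, forall eps : R, 0 < eps < eps0 ->
     (hessian_norm Omega (J eps) <= M%:E)%E /\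
     (hessian_norm Omega (Jhat eps) <= M%:E)%E) ->
  (* Sigma ~ O(1) and Sigma tilde are constant in theta *)
  forall Sigma Sigma_tilde : R -> R,
  (exists c C : R, 0 < c /\
     forall eps : R, 0 < eps < eps0 -> c <= Sigma eps <= C) ->
  (forall eps : R, 0 < eps < eps0 -> forall theta, Omega theta ->
     Sig eps theta = Sigma eps /\ Sigtilde eps theta = Sigma_tilde eps) ->
  let beta := fun eps eta => 2 / (eta * Sigma eps) in
  let beta_hat := fun eps eta => 2 / (eta * (Sigma eps + Sigma_tilde eps)) in
  let p_inf := fun eps eta => gibbs Omega (beta eps eta) (J eps) in
  let p_hat_inf := fun eps eta =>
    gibbs Omega (beta_hat eps eta) (fun theta => J eps theta + Jtilde eps theta) in
  [/\ forall eps eta : R, 0 < eps < eps0 -> 0 < eta ->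
        steady_state Omega (grad (J eps)) (Sigma eps) eta (p_inf eps eta),
      forall eps eta : R, 0 < eps < eps0 -> 0 < eta ->
        0 < Sigma eps + Sigma_tilde eps ->
        steady_state Omega (fun theta => grad (J eps) theta + grad (Jtilde eps) theta)
          (Sigma eps + Sigma_tilde eps) eta (p_hat_inf eps eta)
    & exists C delta : R, 0 < delta /\
        (forall eps : R, 0 < eps < eps0 -> eps < delta ->
           0 < Sigma eps + Sigma_tilde eps) /\
        (forall eps eta : R, 0 < eps < eps0 -> eps < delta ->
           0 < eta -> eps ^+ 2 / eta < delta ->
           (Linfty_norm Omega
              (fun theta => (p_hat_inf eps eta theta / p_inf eps eta theta)%R)
            <= (1 + C * (eps ^+ 2 / eta))%:E)%E)].
Proof.
move=> J Jhat Jtilde Sig Sigtilde J_diff Jtilde_O _ Sigtilde_O J_int _.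
move=> Sigma Sigma_tilde [c [C [c0 Sigma_bounds]]] SigE.
move=> beta beta_hat p_inf p_hat_inf.
have mOmega := open_rV_measurable Omega_open.
have mu_gt0 := lebesgue_rV_open_gt0 Omega_open Omega_ne.
have mu_fin := lebesgue_rV_bounded_ltoo mOmega Omega_bounded.
have [Br rewB] := rew_bounded; have [Bv VB] := V_bounded.
pose B := 2^-1 * (Br + Bv *+ 2) ^+ 2.
have JB eps theta : 0 < eps < eps0 -> Omega theta -> `|J eps theta| <= B.
  move=> heps Ot; apply: obj_bounded => // [|x|k]; [exact: V_measurable|exact: VB|].
  exact: chain_measurable (hchain _ heps) k.
have JhatB eps theta : 0 < eps < eps0 -> Omega theta -> `|Jhat eps theta| <= B.
  move=> heps Ot; apply: obj_hat_bounded => // [|x|k]; [exact: V_measurable|exact: VB|].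
  exact: chain_measurable (hchain _ heps) k.
have JDJtilde eps : (fun theta => J eps theta + Jtilde eps theta) = Jhat eps.
  by apply/funext => theta; rewrite /Jtilde /obj_tilde addrC subrK.
(* Measurability of the objectives in the parameter is extracted from the
   integrability of [exp (- J)]. *)
have measurable_of_exp f : (lebesgue_rV d).-integrable Omega
    (fun theta => (expR (- f theta))%:E) -> measurable_fun Omega f.
  move=> /measurable_int/measurable_EFinP mexp.
  rewrite (_ : f = fun theta => - ln (expR (- f theta))); last first.
    by apply/funext => theta; rewrite expRK opprK.
  by apply: measurableT_comp => //; exact: (measurableT_comp (@measurable_ln R)).
have mJ eps : 0 < eps < eps0 -> measurable_fun Omega (J eps).
  by move=> /J_int[/measurable_of_exp].
have mJhat eps : 0 < eps < eps0 -> measurable_fun Omega (Jhat eps).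
  by move=> /J_int[_ /measurable_of_exp].
split.
- move=> eps eta heps eta0.
  have /andP[Sc _] := Sigma_bounds _ heps.
  apply: gibbs_steady_state => //; first exact: lt_le_trans Sc.
    by move=> theta /(J_diff _ heps).1[].
  by apply: gibbs_probability_density (mJ _ heps) _ => // theta; exact: JB.
- move=> eps eta heps eta0 S0; rewrite /p_hat_inf JDJtilde.
  have [dJ dJhat] := J_diff _ heps.
  apply: gibbs_steady_state => //.
  + by move=> theta /dJhat[].
  + move=> theta Ot; rewrite -JDJtilde; apply/rowP => i; rewrite !mxE.
    have [dJt _] := dJ _ Ot; have [dJht _] := dJhat _ Ot.
    rewrite [RHS]deriveD//; first exact: diff_derivable.
    by apply: diff_derivable; exact: differentiableB.
  + by apply: gibbs_probability_density (mJhat _ heps) _ => // theta; exact: JhatB.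
have sq_ge0 (e : R) : 0 <= e ^+ 2 by exact: sqr_ge0.
have [K1 [d1 [K1_0 d1_0 Jt]]] := unif_bigO_ex sq_ge0 Jtilde_O.
have [K2 [d2 [K2_0 d2_0 St]]] := unif_bigO_ex sq_ge0 Sigtilde_O.
have B0 : 0 <= B by rewrite mulr_ge0 ?sqr_ge0.
pose A := 4 * (K1 / c + B * K2 / c ^+ 2).
have A0 : 0 <= A.
  apply: mulr_ge0 => //; apply: addr_ge0; apply: divr_ge0 => //.
  - exact: ltW.
  - exact: mulr_ge0.
pose d3 := c / (2 * (K2 + 1)); pose d4 := (4 * (A + 1))^-1.
have d3_0 : 0 < d3 by rewrite divr_gt0// mulr_gt0//; lra.
have d4_0 : 0 < d4 by rewrite invr_gt0; lra.
(* [d1], [d2]: validity of the two asymptotic bounds; [1], [d3]: they make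
   [K2 * eps ^+ 2 <= c / 2], so that the perturbed variance stays above [c / 2];
   [d4]: the exponent [2 * (A * x)] stays below [1 / 2]. *)
pose delta := Num.min (Num.min d1 d2) (Num.min (Num.min 1 d3) d4).
have St_le eps : 0 < eps < eps0 -> eps < delta -> `|Sigma_tilde eps| <= K2 * eps ^+ 2.
  move=> heps; rewrite !lt_min => /andP[/andP[_ ed2] _].
  have [theta Ot] := Omega_ne; rewrite -(SigE _ heps _ Ot).2.
  by apply: St => //; case/andP: heps => ->.
have v_ge eps : 0 < eps < eps0 -> eps < delta -> c / 2 <= Sigma eps + Sigma_tilde eps.
  move=> heps ed; have := St_le _ heps ed.
  have /andP[Sc _] := Sigma_bounds _ heps.
  move: ed; rewrite !lt_min => /andP[_ /andP[/andP[e1 e3] _]].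
  have /andP[e0 _] := heps.
  rewrite ler_norml => /andP[Stl _].
  have : K2 * eps ^+ 2 <= c / 2.
    have : eps * (2 * (K2 + 1)) < c by rewrite -ltr_pdivlMr//; lra.
    have : eps ^+ 2 <= eps by rewrite expr2 ler_piMl// ltW.
    nra.
  lra.
exists (4 * A), delta; split.
  by rewrite !lt_min d1_0 d2_0 d3_0 d4_0 ltr01.
split=> [eps heps ed|eps eta heps ed eta0 ed'].
  by apply: lt_le_trans (v_ge _ heps ed); rewrite divr_gt0.
have /andP[e0 _] := heps.
have /andP[Sc _] := Sigma_bounds _ heps.
set x := eps ^+ 2 / eta.
have x0 : 0 <= x by rewrite divr_ge0 ?sqr_ge0 ?ltW.
have Ax : A * x *+ 2 <= 2^-1.
  move: ed'; rewrite !lt_min -/x => /andP[_ /andP[_]].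
  rewrite /d4 -div1r ltr_pdivlMr; last by lra.
  by rewrite mulr2n; nra.
have expo theta : Omega theta ->
    `|beta eps eta * J eps theta - beta_hat eps eta * Jhat eps theta| <= A * x.
  move=> Ot.
  have -> : A * x = 4 * (K1 * eps ^+ 2 / c + B * (K2 * eps ^+ 2) / c ^+ 2) / eta.
    by rewrite /A /x; field; rewrite !gt_eqF.
  apply: gibbs_exponent_diff => //.
  - exact: v_ge.
  - exact: JB.
  - rewrite -[_ - _]/(Jtilde eps theta); apply: Jt => //.
    by rewrite e0 /=; move: ed; rewrite !lt_min => /andP[/andP[]].
  - by rewrite addrAC subrr add0r; exact: St_le.
apply: Linfty_norm_le => [|theta Ot].
  by rewrite -/x addr_ge0// mulr_ge0// mulr_ge0.
rewrite /p_hat_inf JDJtilde.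
have /andP[r0 rL] := gibbs_ratio_le mOmega mu_gt0 mu_fin
  (mJ _ heps) (fun t => JB _ t heps) (mJhat _ heps) (fun t => JhatB _ t heps)
  expo Ot.
have Ax_ge0 : 0 <= A * x *+ 2 by rewrite mulrn_wge0// mulr_ge0.
rewrite ger0_norm// (le_trans rL)// (le_trans (expR_le_affine Ax_ge0 Ax))// -/x.
by rewrite mulr2n; lra.
Qed.
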